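(* There is a universal constant $c>0$ such that for all sufficiently large $N$ and any $M\ge N+1$, if $m,p,H$ are positive integers with $mpH\le cN/\log\log N$, then there is no $f\in\mathcal{T}^{1,H}_{1,m,1,p}$ satisfying $f(X)=\mathrm{Match3}(X)$ for all $X\in[M]^N$.
   Context: $[M]=\{1,\dots,M\}$. For $X=(x_1,\dots,x_N)\in[M]^N$, $\mathrm{Match3}(X)\in\{0,1\}^N$ is defined by $\mathrm{Match3}(X)_i=1$ if there exist $j_1,j_2\in[N]$ with $x_i+x_{j_1}+x_{j_2}\equiv0\pmod M$, and $0$ otherwise. Self-attention. The row-wise softmax is $\mathrm{softmax}(A)_{i,j}=\exp(A_{i,j})/\sum_{j'}\exp(A_{i,j'})$. For $Q,K\in\mathbb{R}^{d\times m}$, $V\in\mathbb{R}^{d\times d'}$ encoded using $p$-bit fixed-point numbers, a self-attention unit is $f_{Q,K,V}:\mathbb{R}^{N\times d}\to\mathbb{R}^{N\times d'}$, $f_{Q,K,V}(X)=\mathrm{softmax}(XQK^{\mathsf T}X^{\mathsf T})XV$; $\mathcal{A}_{d,m,d',p}$ is the set of all such units. An $H$-headed attention layer is a sum $X\mapsto\sum_{h=1}^Hf_h(X)$ with $f_1,\dots,f_H\in\mathcal{A}_{d,m,d',p}$; $\mathcal{A}^H_{d,m,d',p}$ is the set of these. MLP layer. $\Phi_{d,d',p}$ is the set of all (arbitrary) functions $\phi:\mathbb{R}^d\to\mathbb{R}^{d'}$ whose real-valued inputs and outputs can be represented using $p$-bit fixed-precision numbers, applied row-wise. One-layer $H$-headed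 transformer: $\mathcal{T}^{1,H}_{d,m,d',p}=\Phi_{m,d',p}\,\mathcal{A}^H_{m,m,m,p}\,\Phi_{d,m,p}$ (composition: input MLP, multi-headed attention layer, output MLP). *)

(* Defs.v *)
From HB Require Import structures.
From mathcomp Require Import all_boot all_order all_algebra.
From mathcomp Require Import all_classical all_reals all_analysis.

Set Implicit Arguments.
Unset Strict Implicit.
Unset Printing Implicit Defensive.

Import Order.TTheory GRing.Theory Num.Theory.

Local Open Scope classical_set_scope.
Local Open Scope ring_scope.

(* [M]^N, as functions 'I_N -> nat with values in {1, ..., M}. *)
Definition words (M N : nat) : set ('I_N -> nat) :=
  [set X | forall i, (1 <= X i <= M)%N].

Definition Match3 (M N : nat) (X : 'I_N -> nat) (i : 'I_N) : bool :=
  [exists j1 : 'I_N, [exists j2 : 'I_N, X i + X j1 + X j2 == 0 %[mod M]]]%N.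

Section Transformers.
Variable R : realType.

(* The p-bit (two's complement) fixed-point numbers with s fractional bits.
   The position s of the binary point is a parameter of the format; it is
   allowed to be any integer. *)
Definition fixed_point (p : nat) (s : int) : set R :=
  [set k%:~R * 2%:R ^ (- s) |
    k in [set k : int | - 2%:R ^+ p.-1 <= k < 2%:R ^+ p.-1]].

(* A rounding onto a fixed-point format: a monotone retraction of R onto it.
   Rounding to nearest (whatever the treatment of ties), down, up, or towards
   zero, with saturation on overflow, are all of this form. *)
Definition is_rounding (p : nat) (s : int) (rnd : R -> R) : Prop :=
  [/\ forall x, fixed_point p s (rnd x),
      forall x, fixed_point p s x -> rnd x = x
    & {homo rnd : x y / x <= y}].

Definition fixed_point_mx (p d d' : nat) (A : 'M[R]_(d, d')) : Prop :=
  exists s : int, forall i j, fixed_point p s (A i j).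

Definition softmax (n n' : nat) (A : 'M[R]_(n, n')) : 'M[R]_(n, n') :=
  \matrix_(i, j) (expR (A i j) / \sum_j' expR (A i j')).

Definition self_attention (N d m d' : nat) (Q K : 'M[R]_(d, m))
    (V : 'M[R]_(d, d')) (X : 'M[R]_(N, d)) : 'M[R]_(N, d') :=
  softmax (X *m Q *m K^T *m X^T) *m X *m V.

Definition attention_unit (N d m d' p : nat) :
    set ('M[R]_(N, d) -> 'M[R]_(N, d')) :=
  [set f | exists Q K : 'M[R]_(d, m), exists V : 'M[R]_(d, d'),
     [/\ fixed_point_mx p Q, fixed_point_mx p K, fixed_point_mx p V
       & f = self_attention Q K V]].

Definition attention_layer (N H d m d' p : nat) :
    set ('M[R]_(N, d) -> 'M[R]_(N, d')) :=
  [set f | exists fs : 'I_H -> ('M[R]_(N, d) -> 'M[R]_(N, d')),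
     (forall h, attention_unit m p (fs h)) /\
     f = (fun X => \sum_(h < H) fs h X)].

(* Arbitrary functions with p-bit inputs and outputs. The values fed to the
   output MLP of a transformer are softmax averages, which are in general not
   representable; so phi is a total function on R^d, and having p-bit inputs
   means that phi x depends only on the rounding of the entries of x to a
   p-bit format. No rounding takes place on entries which are already
   representable. *)
Definition mlp (d d' p : nat) : set ('rV[R]_d -> 'rV[R]_d') :=
  [set phi |
     (exists (s : int) (rnd : R -> R),
        is_rounding p s rnd /\ forall x, phi x = phi (map_mx rnd x)) /\
     (exists t : int, forall x j, fixed_point p t (phi x 0 j))].

Definition rowwise (N d d' : nat) (phi : 'rV[R]_d -> 'rV[R]_d')
    (X : 'M[R]_(N, d)) : 'M[R]_(N, d') :=
  \matrix_(i < N) phi (row i X).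

Definition transformer1 (N H d m d' p : nat) :
    set ('M[R]_(N, d) -> 'M[R]_(N, d')) :=
  [set f | exists (phi : 'rV[R]_d -> 'rV[R]_m)
                  (g : 'M[R]_(N, m) -> 'M[R]_(N, m))
                  (psi : 'rV[R]_m -> 'rV[R]_d'),
     [/\ mlp p phi, attention_layer H m p g, mlp p psi
       & f = rowwise psi \o g \o rowwise phi]].

End Transformers.

(* Main.v *)
Require Import Defs.
From HB Require Import structures.
From mathcomp Require Import all_boot all_order all_algebra.
From mathcomp Require Import all_classical all_reals all_analysis.
From mathcomp Require Import ring lra zify.

(* Fix the token z = n + 1 at position 0, put tokens encoding a set S of
   {1, ..., n} at positions 1, ..., n, and the token M - z - i everywhere else:
   then position 0 has a match if and only if i belongs to S. So an attention
   layer computing Match3 must separate all 2 ^ n sets S by n probes i. For a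
   given i, the input of the output MLP at position 0 is the rounding of m sums
   of H fractions, whose numerators and denominators depend on S only through
   H + H m additive real parameters; comparing them with the 2 ^ p rounding
   thresholds amounts to taking the signs of n m 2 ^ p polynomials of degree at
   most H + 1 in these parameters. By a bound of Warren type, the number of sign
   patterns is at most (O(n m 2 ^ p H)) ^ (H + H m). Moreover the input MLP must
   not identify two of the tokens 1, ..., n, so n <= 2 ^ p, and taking logarithms
   gives n = O(m p H), even without the factor log log N.

   The bound on sign patterns: if f_1, ..., f_s have degree at most d, then on
   each cell of the complement of their zeros g = (f_1 ... f_s)^2 - e |x|_D^D
   has a local maximum as soon as e is small, where D = 2 s d + 2. At a critical
   point of g, the power x_i ^ (D - 1) equals a polynomial of degree less than
   D - 1, so the functions on the set of these critical points are spanned by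
   the (D - 1)^k monomials in x_1, ..., x_k with all exponents at most D - 2. *)

Import Order.TTheory GRing.Theory Num.Theory.
Import numFieldNormedType.Exports.

Local Open Scope classical_set_scope.
Local Open Scope ring_scope.

(** * Polynomial functions of bounded degree *)

(** Polynomials in k variables enter only as functions; the index is an upper bound for the total
    degree, and inductions on derivations replace coefficients. *)
Inductive polyfun (R : realType) (k : nat) : nat -> ('rV[R]_k -> R) -> Prop :=
| polyfun_const n c : polyfun R k n (fun=> c)
| polyfun_coord n i : polyfun R k n.+1 (fun x => x 0 i)
| polyfun_add n f g :
    polyfun R k n f -> polyfun R k n g -> polyfun R k n (fun x => f x + g x)
| polyfun_mul n p f g : polyfun R k n f -> polyfun R k p g ->
    polyfun R k (n + p) (fun x => f x * g x).

Arguments polyfun {R k} n f.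

Section PolynomialFunctions.
Context {R : realType} {k : nat}.
Implicit Types (f g : 'rV[R]_k -> R) (n p : nat).

Lemma polyfun_ext n f g : polyfun n f -> f =1 g -> polyfun n g.
Proof. by move=> nf /funext <-. Qed.

Lemma polyfun_le n p f : (n <= p)%N -> polyfun n f -> polyfun p f.
Proof.
move=> np nf; rewrite -(subnKC np).
apply: (polyfun_ext _ _ _ (polyfun_mul _ _ _ (p - n) _ _ nf
  (polyfun_const _ _ _ 1))) => x.
by rewrite mulr1.
Qed.

Lemma polyfun_sum (I : Type) (s : seq I) (P : pred I) n (F : I -> 'rV[R]_k -> R) :
  (forall i, P i -> polyfun n (F i)) ->
  polyfun n (fun x => \sum_(i <- s | P i) F i x).
Proof.
move=> nF; elim: s => [|i s IH].
  by apply: (polyfun_ext _ _ _ (polyfun_const _ _ n 0)) => x; rewrite big_nil.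
have [Pi|nPi] := boolP (P i).
  apply: (polyfun_ext _ _ _ (polyfun_add _ _ _ _ _ (nF _ Pi) IH)) => x.
  by rewrite big_cons Pi.
by apply: (polyfun_ext _ _ _ IH) => x; rewrite big_cons (negbTE nPi).
Qed.

Lemma polyfun_prod (I : Type) (s : seq I) (P : pred I) n (F : I -> 'rV[R]_k -> R) :
  (forall i, P i -> polyfun n (F i)) ->
  polyfun (count P s * n) (fun x => \prod_(i <- s | P i) F i x).
Proof.
move=> nF; elim: s => [|i s IH].
  by apply: (polyfun_ext _ _ _ (polyfun_const _ _ 0 1)) => x; rewrite big_nil.
have [Pi|nPi] := boolP (P i).
  rewrite /= Pi mulSn.
  apply: (polyfun_ext _ _ _ (polyfun_mul _ _ _ _ _ _ (nF _ Pi) IH)) => x.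
  by rewrite big_cons Pi.
rewrite /= (negbTE nPi).
by apply: (polyfun_ext _ _ _ IH) => x; rewrite big_cons (negbTE nPi).
Qed.

Lemma polyfun_exp n (i : 'I_k) : polyfun n (fun x : 'rV[R]_k => x 0 i ^+ n).
Proof.
elim: n => [|n IH]; first exact: polyfun_const.
apply: (polyfun_ext _ _ _ (polyfun_mul _ _ 1 _ _ _ (polyfun_coord _ _ 0 i) IH)) => x.
by rewrite exprS.
Qed.

Lemma polyfun_continuous n f : polyfun n f -> continuous f.
Proof.
elim=> {n f} [n c|n i|n f g _ cf _ cg|n p f g _ cf _ cg] x.
- exact: cst_continuous.
- exact: coord_continuous.
- exact: continuousD (cf x) (cg x).
- exact: continuousM (cf x) (cg x).
Qed.

Lemma polyfun_growth n f : polyfun n f -> exists2 C : R, 0 <= C &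
  forall (x : 'rV[R]_k) r, 1 <= r -> (forall i, `|x 0 i| <= r) -> `|f x| <= C * r ^+ n.
Proof.
elim=> {n f} [n c|n i|n f g _ [C C0 HC] _ [D D0 HD]|n p f g _ [C C0 HC] _ [D D0 HD]].
- exists `|c| => // x r r1 _.
  by rewrite ler_peMr// exprn_ege1.
- exists 1 => // x r r1 xr; rewrite mul1r (le_trans (xr i))// exprS.
  by rewrite ler_peMr ?exprn_ege1// (le_trans ler01).
- exists (C + D) => [|x r r1 xr]; first exact: addr_ge0.
  by rewrite mulrDl (le_trans (ler_normD _ _))// lerD ?HC ?HD.
- exists (C * D) => [|x r r1 xr]; first exact: mulr_ge0.
  by rewrite normrM exprD mulrACA ler_pM ?HC ?HD.
Qed.

Lemma is_derive_coord_line (x : 'rV[R]_k) (t : R) (i j : 'I_k) :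
  is_derive t (1 : R) (fun t => (x + t *: delta_mx 0 i) 0 j) (j == i)%:R.
Proof.
rewrite (_ : (fun t => _) = cst (x 0 j) + (j == i)%:R \*: id).
  by apply: is_derive_eq; rewrite add0r [_ *: _]mulr1.
by apply/funext => s; rewrite !fctE !mxE /= mulrC.
Qed.

(** The degree bound is not lowered by differentiation: at a critical point, a bound 2n against the
    power 2n + 1 is already enough. *)
Lemma polyfun_partial n f (i : 'I_k) : polyfun n f -> exists2 df, polyfun n df &
  forall x t, is_derive t (1 : R) (fun t => f (x + t *: delta_mx 0 i))
    (df (x + t *: delta_mx 0 i)).
Proof.
elim=> {n f} [n c|n j|n f g _ [df nf Hf] _ [dg ng Hg]
  |n p f g nf [df ndf Hf] ng [dg ndg Hg]].
- exists (fun=> 0) => [|x t]; first exact: polyfun_const.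
  exact: is_derive_cst.
- exists (fun=> (j == i)%:R) => [|x t]; first exact: polyfun_const.
  exact: is_derive_coord_line.
- exists (fun x => df x + dg x) => [|x t]; first exact: polyfun_add.
  exact: is_deriveD.
- exists (fun x => f x * dg x + g x * df x) => [|x t].
    apply: polyfun_add; first exact: polyfun_mul.
    by rewrite addnC; exact: polyfun_mul.
  exact: is_deriveM.
Qed.

(** * Monomials and reduction on a finite set of points *)

Definition monom (e : {ffun 'I_k -> nat}) (x : 'rV[R]_k) : R :=
  \prod_i x 0 i ^+ e i.

Lemma monomD (e e' : {ffun 'I_k -> nat}) x :
  monom [ffun i => e i + e' i]%N x = monom e x * monom e' x.
Proof.
by rewrite /monom -big_split; apply: eq_bigr => i _; rewrite ffunE exprD.
Qed.

(** Expansion into monomials, phrased as an induction principle. Since [W] is quantified after the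
    derivation, the product case can use the hypothesis on f for multiplication by g, then the one
    on g for multiplication by a monomial. *)
Lemma polyfun_monom_ind n f : polyfun n f ->
  forall W : ('rV[R]_k -> R) -> Prop,
  (forall g h, W g -> W h -> W (fun x => g x + h x)) ->
  (forall c (e : {ffun 'I_k -> nat}), (\sum_i e i <= n)%N ->
    W (fun x => c * monom e x)) -> W f.
Proof.
elim=> {n f} [n c|n j|n f g _ IHf _ IHg|n p f g _ IHf _ IHg] W WD Wm.
- have /Wm : (\sum_(i < k) [ffun=> 0%N] i <= n)%N.
    by rewrite big1// => i _; rewrite ffunE.
  move=> /(_ c) Wc; apply: (eq_ind _ W Wc); apply/funext => x.
  by rewrite /monom big1 ?mulr1// => i _; rewrite ffunE.
- have /Wm : (\sum_(i < k) [ffun i => (i == j : nat)] i <= n.+1)%N.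
    rewrite (bigD1 j)//= ffunE eqxx big1 ?addn0// => i /negbTE ij.
    by rewrite ffunE ij.
  move=> /(_ 1) Wc; apply: (eq_ind _ W Wc); apply/funext => x; rewrite mul1r.
  rewrite /monom (bigD1 j)//= ffunE eqxx expr1 big1 ?mulr1// => i /negbTE ij.
  by rewrite ffunE ij.
- exact: WD (IHf W WD Wm) (IHg W WD Wm).
- apply: (IHf (fun f => W (fun x => f x * g x))) => [f1 f2 W1 W2|c e en].
    rewrite (_ : (fun x => _) = (fun x => f1 x * g x + f2 x * g x)).
      exact: WD.
    by apply/funext => x; rewrite mulrDl.
  apply: (IHg (fun g => W (fun x => c * monom e x * g x))) => [g1 g2 W1 W2|c' e' ep].
    rewrite (_ : (fun x => _) =
        (fun x => c * monom e x * g1 x + c * monom e x * g2 x)).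
      exact: WD.
    by apply/funext => x; rewrite mulrDr.
  have /Wm : (\sum_(i < k) [ffun i => e i + e' i]%N i <= n + p)%N.
    by under eq_bigr do rewrite ffunE; rewrite big_split leq_add.
  move=> /(_ (c * c')) Wc; apply: (eq_ind _ W Wc); apply/funext => x.
  by rewrite monomD; ring.
Qed.

Lemma polyfun_opp n f : polyfun n f -> polyfun n (fun x => - f x).
Proof.
move=> nf; apply: (polyfun_ext _ _ _ (polyfun_mul _ _ 0 _ _ _
  (polyfun_const _ _ 0 (-1)) nf)) => x.
by rewrite mulN1r.
Qed.

(** Lagrange interpolation: the product of the normalised squared distances to the other points. *)
Lemma polyfun_delta (T : finType) (x : T -> 'rV[R]_k) t0 : injective x ->
  exists n, exists2 f, polyfun n f & forall t, f (x t) = (t == t0)%:R.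
Proof.
move=> xI.
pose sq t (y : 'rV[R]_k) := \sum_i (y 0 i - x t 0 i) * (y 0 i - x t 0 i).
have sq0 t y : (sq t y == 0) = (y == x t).
  rewrite psumr_eq0 => [|i _]; last by rewrite -expr2 sqr_ge0.
  apply/idP/eqP => [/allP yx|->].
    apply/rowP => i; have := yx i (mem_index_enum _).
    by rewrite mulf_eq0 orbb subr_eq0 => /eqP.
  by apply/allP => i _; rewrite subrr mul0r eqxx.
exists (count (fun t => t != t0) (index_enum T) * 2)%N.
exists (fun y => \prod_(t | t != t0) ((sq t (x t0))^-1 * sq t y)) => [|t].
  apply: polyfun_prod => t _; apply: (polyfun_mul _ _ 0 2).
    exact: polyfun_const.
  apply: polyfun_sum => i _; apply: (polyfun_mul _ _ 1 1);
    by apply: polyfun_add; [exact: polyfun_coord|exact: polyfun_const].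
have [->|tt0] := eqVneq t t0.
  rewrite big1// => s st0; rewrite mulVf// sq0.
  by apply: contraNneq st0 => /xI ->.
rewrite (bigD1 t)//=.
by have /eqP -> : sq t (x t) == 0; rewrite ?sq0// mulr0 mul0r.
Qed.

(** Replacing x_i ^ (d + 1) by [q i] lowers the total degree, so on the points every polynomial
    becomes a combination of the (d + 1)^k monomials with exponents at most d. Interpolation makes
    these span all functions on [T]. *)
Lemma card_reduced_points (T : finType) (x : T -> 'rV[R]_k) d
    (q : 'I_k -> 'rV[R]_k -> R) :
  injective x -> (forall i, polyfun d (q i)) ->
  (forall t i, x t 0 i ^+ d.+1 = q i (x t)) -> (#|T| <= d.+1 ^ k)%N.
Proof.
move=> xI qd xq.
pose E := {ffun 'I_k -> 'I_d.+1}.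
pose red (e : E) (y : 'rV[R]_k) := \prod_i y 0 i ^+ e i.
pose W (f : 'rV[R]_k -> R) :=
  exists c : E -> R, forall t, f (x t) = \sum_e red e (x t) * c e.
have WD g h : W g -> W h -> W (fun y => g y + h y).
  move=> [c gc] [c' hc']; exists (fun e => c e + c' e) => t.
  by rewrite gc hc' -big_split; apply: eq_bigr => e _; rewrite /= mulrDr.
have WZ a g : W g -> W (fun y => a * g y).
  move=> [c gc]; exists (fun e => a * c e) => t.
  by rewrite gc mulr_sumr; apply: eq_bigr => e _; rewrite mulrCA.
have Weq f g : (forall t, f (x t) = g (x t)) -> W g -> W f.
  by move=> fg [c gc]; exists c => t; rewrite fg.
have Wm n : forall e : {ffun 'I_k -> nat}, (\sum_i e i)%N = n -> W (monom e).
  elim/ltn_ind: n => n IH e en.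
  have [/forallP ed|/forallPn[i]] := boolP [forall i, e i <= d]%N.
    pose e0 : E := [ffun i => inord (e i)].
    exists (fun e' => (e' == e0)%:R) => t.
    rewrite (bigD1 e0)//= eqxx mulr1 big1 ?addr0 => [|e' /negbTE ->];
      last by rewrite mulr0.
    by apply: eq_bigr => i _; rewrite ffunE inordK// ltnS ed.
  rewrite -ltnNge => di.
  (* One factor x_i ^ (d + 1) is split off and replaced by [q i], of degree at most d; every
     resulting monomial has smaller total degree. *)
  pose e' := [ffun j => if j == i then e j - d.+1 else e j]%N.
  have ee' : (d.+1 + \sum_j e' j)%N = n.
    rewrite -en (bigD1 i)//= [RHS](bigD1 i)//= ffunE eqxx addnA subnKC//.
    by congr addn; apply: eq_bigr => j /negbTE ji; rewrite ffunE ji.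
  apply: (Weq _ (fun y => q i y * monom e' y)) => [t|].
    rewrite -xq /monom (bigD1 i)//= [in RHS](bigD1 i)//= mulrA ffunE eqxx -exprD subnKC//.
    by congr (_ * _); apply: eq_bigr => j /negbTE ji; rewrite ffunE ji.
  apply: (polyfun_monom_ind _ _ (qd i) (fun f => W (fun y => f y * monom e' y)))
    => [g h Wg Wh|c e2 e2d].
    by apply: Weq (WD _ _ Wg Wh) => t; rewrite mulrDl.
  apply: Weq (WZ c (monom [ffun j => e2 j + e' j]%N) _) => [t|];
    first by rewrite monomD mulrA.
  apply: IH (erefl _).
  by under eq_bigr do rewrite ffunE; rewrite big_split /= -ee' ltn_add2r ltnS.
have Wpoly n f : polyfun n f -> W f.
  move=> nf; apply: (polyfun_monom_ind _ _ nf) => // c e _.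
  by apply: WZ; exact: Wm (erefl _).
have delta t0 : exists c : E -> R, forall t, \sum_e red e (x t) * c e = (t == t0)%:R.
  have [n [f /Wpoly[c fc] ft]] := polyfun_delta T x t0 xI.
  by exists c => t; rewrite -fc.
have [c ct] := choice delta.
pose A := \matrix_(i < #|T|, j < #|E|) red (enum_val j) (x (enum_val i)).
pose B := \matrix_(j < #|E|, i < #|T|) c (enum_val i) (enum_val j).
(* The identity of size #|T| factors through dimension #|E|, which bounds its rank. *)
have AB : A *m B = 1%:M.
  apply/matrixP => i j; rewrite !mxE -(inj_eq enum_val_inj) -ct.
  rewrite [RHS](reindex_onto enum_val enum_rank) => [|e _]; last exact: enum_rankK.
  by apply: eq_big => [l|l _]; rewrite ?enum_valK ?eqxx ?mxE.
have := mxrankM_maxl A B; rewrite AB mxrank1 => /leq_trans/(_ (rank_leq_col A)).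
by rewrite card_ffun !card_ord.
Qed.

End PolynomialFunctions.

(** * Counting strict sign patterns *)

Lemma finite_pos_lower_bound (R : realType) (T : finType) (u : T -> R) :
  (forall t, 0 < u t) -> exists2 e : R, 0 < e & forall t, e <= u t.
Proof.
move=> u0; exists (\big[Num.min/1]_t u t) => [|t]; last exact: bigmin_le.
by elim/big_rec: _ => // i a _ a0; rewrite lt_min a0 u0.
Qed.

Section SignPatterns.
Context {R : realType} {k : nat}.
Implicit Types (y : 'rV[R]_k).

(** The penalty |y|_D^D with D = 2n + 2: D is even, and exceeds by two the degree 2n of the squared
    product. *)
Let powsum n y := \sum_i y 0 i ^+ (n + n).+2.

Let powsum_ge0 n y : 0 <= powsum n y.
Proof.
apply: sumr_ge0 => i _.
by rewrite (_ : (n + n).+2 = (n.+1 * 2)%N) ?exprM ?sqr_ge0//; lia.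
Qed.

(** If r is the maximum of 1 and all |y_i|, then G <= C r^(2n) while the penalty is at least e
    (r^(2n+2) - 1); positivity of the difference gives e r^2 <= C + e. *)
Let powsum_coercive n (G : 'rV[R]_k -> R) (e : R) : polyfun (n + n) G -> 0 < e ->
  exists B : R, forall y, 0 < G y - e * powsum n y -> forall i, `|y 0 i| < B.
Proof.
move=> /polyfun_growth[C C0 GC] e0; exists (C / e + 2) => y gy i.
pose r := \big[Num.max/1]_j `|y 0 j|.
have r1 : 1 <= r by exact: bigmax_ge_id.
have yr j : `|y 0 j| <= r by exact: le_bigmax.
apply: le_lt_trans (yr i) _.
have rS : r ^+ (n + n).+2 <= 1 + powsum n y.
  have pj j : 0 <= y 0 j ^+ (n + n).+2.
    by rewrite (_ : (n + n).+2 = (n.+1 * 2)%N) ?exprM ?sqr_ge0//; lia.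
  rewrite /r; apply: (big_ind (fun r => r ^+ (n + n).+2 <= 1 + powsum n y)).
  - by rewrite expr1n lerDl powsum_ge0.
  - by move=> a b; rewrite /Num.max; case: ifP.
  - move=> j _; rewrite -normrX ger0_norm// (le_trans _ (_ : powsum n y <= _)) ?lerDr//.
    by rewrite /powsum (bigD1 j)//= lerDl sumr_ge0.
have Gr := le_trans (ler_norm _) (GC y r r1 yr).
have rn0 : 1 <= r ^+ (n + n) by exact: exprn_ege1.
have : e * r ^+ 2 <= C + e.
  rewrite -(@ler_pM2r _ (r ^+ (n + n))) ?(lt_le_trans ltr01)//.
  rewrite -mulrA -exprD add2n.
  have := ler_wpM2l (ltW e0) rS; rewrite mulrDr mulr1 => h1.
  have : e <= e * r ^+ (n + n) by rewrite ler_peMr// ltW.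
  rewrite mulrDl; lra.
rewrite mulrC -ler_pdivlMr// mulrDl mulfV ?gt_eqF// => h2.
by have : r <= r ^+ 2 by [rewrite expr2 ler_peMr// (le_trans ler01)]; lra.
Qed.

Let powsum_line n y j (t : R) :
  is_derive t (1 : R) (fun t => powsum n (y + t *: delta_mx 0 j))
    ((n + n).+2%:R * (y + t *: delta_mx 0 j) 0 j ^+ (n + n).+1).
Proof.
have H (i : 'I_k) := is_deriveX (n + n).+2 (is_derive_coord_line y t j i).
have := is_derive_sum H.
rewrite (_ : \sum_i _ = fun t => powsum n (y + t *: delta_mx 0 j)).
  move=> /is_derive_eq; apply.
  rewrite (bigD1 j)//= eqxx big1 ?addr0 => [|i /negbTE ->]; last exact: mulr0.
  by rewrite [LHS]mulr1.
by apply/funext => s; rewrite fct_sumE; apply: eq_bigr => i _; rewrite fctE.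
Qed.

(** Each [x t] is replaced by a maximiser [y t] of [g] on its closed sign cell. Signs are kept, so
    the [y t] are distinct; each is a critical point of [g], so [card_reduced_points] applies with d
    = 2n. *)
Lemma card_strict_sign_patterns (T I : finType) d (f : I -> 'rV[R]_k -> R)
    (x : T -> 'rV[R]_k) :
  (forall i, polyfun d (f i)) -> (forall i t, f i (x t) != 0) ->
  (forall t t', (forall i, (0 < f i (x t)) = (0 < f i (x t'))) -> t = t') ->
  (#|T| <= (2 * (#|I| * d)).+1 ^ k)%N.
Proof.
move=> fd fx0 xinj; set n := (#|I| * d)%N.
pose F y := \prod_i f i y; pose G y := F y * F y.
have Fn : polyfun n F.
  by rewrite /n -sum1_card sum1_count; exact: polyfun_prod.
have Gn : polyfun (n + n) G by exact: polyfun_mul.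
have Gx t : 0 < G (x t).
  by rewrite /G -expr2 lt_def sqr_ge0 expf_eq0 andbT /=; apply/prodf_neq0 => i _.
(* One [e] is small enough for all t: [g] is positive at every [x t], hence also at the
   maximisers. *)
have [e e0 ex] := finite_pos_lower_bound R T (fun t => G (x t) / (1 + powsum n (x t)))
  (fun t => divr_gt0 (Gx t) (ltr_wpDr (powsum_ge0 n (x t)) ltr01)).
pose g y := G y - e * powsum n y.
have gx t : 0 < g (x t).
  have := ex t; have S0 := powsum_ge0 n (x t).
  rewrite /= ler_pdivlMr; last by rewrite ltr_wpDr.
  by rewrite mulrDr mulr1 /g => h; lra.
have [B gB] := powsum_coercive n G e Gn e0.
have cg : continuous g.
  apply: (@polyfun_continuous _ _ (n + n).+2); apply: polyfun_add.
    by apply: polyfun_le Gn; lia.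
  apply: polyfun_opp; apply: (polyfun_mul _ _ 0); first exact: polyfun_const.
  apply: polyfun_sum => i _.
  exact: polyfun_exp.
pose A t := [set y : 'rV[R]_k |
  (forall i, y 0 i \in `[-B, B]) /\ forall i, 0 <= f i (x t) * f i y].
have cA t : compact (A t).
  rewrite (_ : A t = [set y : 'rV[R]_k | forall i, `[-B, B]%classic (y 0 i)] `&`
      \bigcap_i [set y | 0 <= f i (x t) * f i y]).
    apply: compact_closedI.
      apply: (rV_compact (A := fun=> `[-B, B]%classic)) => i.
      exact: segment_compact.
    apply: closed_bigI => i _.
    apply: (@preimage_closed _ _ (fun y => f i (x t) * f i y) [set z | 0 <= z]).
      move=> y _; apply: continuousM; first exact: cst_continuous.
      exact: polyfun_continuous (fd i) y.
    exact: closed_ge.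
  by apply/seteqP; split => y [yB yf]; split => // i; [move=> _|]; exact: yf.
have Axt t : A t (x t).
  split => i; last by rewrite -expr2 sqr_ge0.
  by rewrite in_itv/= -ler_norml ltW// gB// gx.
have /choice[y yP] t : exists y, A t y /\ forall z, A t z -> g z <= g y.
  have [||y /set_mem Ay yg] := EVT_max_rV (A := A t) (f := g) _ (cA t).
  - by exists (x t).
  - exact: continuous_subspaceT.
  - by exists y; split=> // z Az; apply: yg; exact: mem_set.
have gy t : 0 < g (y t) by have [_ /(_ _ (Axt t))] := yP t; exact: lt_le_trans.
(* A zero of some [f i] would make [G] vanish and [g] nonpositive, so the maximiser is not on the
   boundary of its cell. *)
have fy i t : 0 < f i (x t) * f i (y t).
  have [[_ /(_ i) ge0] _] := yP t; rewrite lt_def ge0 andbT mulf_neq0//.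
  have : 0 < G (y t).
    have := gy t; rewrite /g subr_gt0; apply: le_lt_trans.
    by rewrite mulr_ge0 ?powsum_ge0// ltW.
  by apply: contraTneq => fi0; rewrite /G /F (bigD1 i)//= fi0 mul0r mul0r ltxx.
have yI : injective y.
  have sgn i t : (0 < f i (x t)) = (0 < f i (y t)).
    by apply/idP/idP => h; [rewrite -(pmulr_rgt0 _ h)|rewrite -(pmulr_lgt0 _ h)].
  by move=> t t' yt; apply: xinj => i; rewrite !sgn yt.
have /choice[dG dGP] j : exists dG, polyfun (n + n) dG /\ forall z t,
    is_derive t (1 : R) (fun t => G (z + t *: delta_mx 0 j)) (dG (z + t *: delta_mx 0 j)).
  by have [dG] := polyfun_partial _ _ j Gn; exists dG.
rewrite mul2n -addnn.
apply: (card_reduced_points _ y _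
  (fun j z => (e * (n + n).+2%:R)^-1 * dG j z) yI) => [j|t j].
  by apply: (polyfun_mul _ _ 0); [exact: polyfun_const|have [] := dGP j].
have dg s : is_derive s (1 : R) (fun s => g (y t + s *: delta_mx 0 j))
   (dG j (y t + s *: delta_mx 0 j) -
    e * ((n + n).+2%:R * (y t + s *: delta_mx 0 j) 0 j ^+ (n + n).+1)).
  have [_ /(_ (y t) s) d1] := dGP j.
  exact: is_deriveB d1 (is_deriveZ e (powsum_line n (y t) j s)).
have cl : continuous (fun s : R => y t + s *: delta_mx 0 j).
  move=> s; apply: cvgD; first exact: cvg_cst.
  exact: scalel_continuous.
have yt0 : y t + 0 *: delta_mx 0 j = y t by rewrite scale0r addr0.
(* The box and sign conditions are strict at [y t], so a short segment in direction j stays in [A t]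
   and [g] is stationary along it. *)
have : \forall s \near (0 : R), A t (y t + s *: delta_mx 0 j).
  have H1 i : \forall s \near (0 : R), `|(y t + s *: delta_mx 0 j) 0 i| < B.
    have : continuous (fun s : R => `|(y t + s *: delta_mx 0 j) 0 i|).
      move=> s; apply: continuous_comp; last exact: norm_continuous.
      exact: (continuous_comp (cl s) (@coord_continuous _ _ _ 0 i _)).
    by move=> /(_ 0) /cvgr_lt; apply; rewrite yt0 gB// gy.
  have H2 i : \forall s \near (0 : R), 0 < f i (x t) * f i (y t + s *: delta_mx 0 j).
    have : continuous (fun s : R => f i (x t) * f i (y t + s *: delta_mx 0 j)).
      move=> s; apply: continuousM; first exact: cst_continuous.
      exact: (continuous_comp (cl s) (polyfun_continuous _ _ (fd i) _)).
    by move=> /(_ 0) /cvgr_gt; apply; rewrite yt0.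
  have {}H1 := filter_forall _ H1; have {}H2 := filter_forall _ H2.
  near=> s.
  have h1 : forall i, `|(y t + s *: delta_mx 0 j) 0 i| < B by near: s; exact: H1.
  have h2 : forall i, 0 < f i (x t) * f i (y t + s *: delta_mx 0 j) by near: s; exact: H2.
  by split => i; [rewrite in_itv/= -ler_norml ltW|rewrite ltW].
move=> /nbhs_ballP[r /= r0 rA].
have [_ ymax] := yP t.
have d0 : is_derive (0 : R) (1 : R) (fun s => g (y t + s *: delta_mx 0 j)) 0.
  apply: (@derive1_at_max _ _ (- r) r) => [|s _||s sr].
  - by rewrite ge0_cp// ltW.
  - by have [] := dg s.
  - by rewrite in_itv/= oppr_lt0 r0.
  - rewrite yt0; apply: ymax; apply: rA.
    by rewrite /ball/= sub0r normrN ltr_norml; move: sr; rewrite in_itv.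
have := derive_val (is_derive := d0); rewrite (derive_val (is_derive := dg 0)) yt0.
move=> /subr0_eq ->.
have n0 : (n + n).+2%:R != 0 :> R by rewrite pnatr_eq0.
by field; rewrite ?gt_eqF.
Unshelve. all: by end_near.
Qed.
End SignPatterns.

(** * Counting tuples of rounded fractions *)

(** An up-closed condition cuts the line at one place, and among finitely many values the cut can be
    moved into a gap. Open and closed half-lines thus both become strict sign conditions. *)
Lemma threshold_gap (R : realType) (T : finType) (v : T -> R) (P : pred R) :
  (forall a b, a <= b -> P a -> P b) ->
  exists c, forall t, v t != c /\ P (v t) = (c < v t).
Proof.
move=> Pmon.
have [/forallP allP|/forallPn[t0 nP0]] := boolP [forall t, P (v t)].
  exists (\big[Num.min/0]_t v t - 1) => t; rewrite allP.
  have ct : \big[Num.min/0]_t v t - 1 < v t.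
    by rewrite ltrBlDr (le_lt_trans (bigmin_le _ t _))// ltrDl.
  by rewrite ct gt_eqF.
have [s nPs smax] := @Order.TotalTheory.arg_maxP _ _ _ t0 (fun t => ~~ P (v t)) v nP0.
have sP t : P (v t) -> v s < v t.
  by move=> Pt; rewrite ltNge; apply: contra nPs => /Pmon; apply.
have [t|e e0 es] := finite_pos_lower_bound R T
  (fun t => if P (v t) then v t - v s else 1).
  by case: ifP => // /sP; rewrite subr_gt0.
exists (v s + e / 2) => t; have := es t; case: ifP => Pt et.
  have ct : v s + e / 2 < v t by lra.
  by rewrite ct gt_eqF.
have /smax ts : ~~ P (v t) by rewrite Pt.
have {}ts : v t <= v s := ts.
have ct : v t < v s + e / 2 by lra.
by rewrite lt_eqF// ltNge ltW.
Qed.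

Lemma fixed_point_enum (R : realType) p s : (0 < p)%N ->
  exists lev : 'I_(2 ^ p) -> R, forall y, fixed_point p s y -> exists l, y = lev l.
Proof.
move=> p0.
exists (fun l => ((l : nat)%:Z - 2%:R ^+ p.-1)%:~R * 2%:R ^ (- s)).
move=> _ [k /= /andP[k1 k2] <-].
have E : 2%:R ^+ p.-1 = (2 ^ p.-1)%N%:Z by rewrite -natrX natz.
have Ep : (2 ^ p = 2 ^ p.-1 + 2 ^ p.-1)%N by rewrite addnn -mul2n -expnS prednK.
have kp : (absz (k + (2 ^ p.-1)%N%:Z)%R < 2 ^ p)%N by rewrite E in k1 k2; lia.
exists (Ordinal kp); congr (_%:~R * _); rewrite E in k1 k2 *; rewrite /=; lia.
Qed.

(** A rounded value is determined by the levels it reaches. By monotonicity of [rnd], reaching a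
    level is a threshold condition on the fraction sum; clearing the positive denominators turns it
    into the sign of a polynomial in the H + H m parameters [A t], [B t]. *)
Lemma card_rounded_fractions (R : realType) (T I : finType) (m H p : nat) (s : int)
    (rnd : R -> R) (A : T -> 'I_H -> R) (B : T -> 'I_H -> 'I_m -> R)
    (C : I -> 'I_H -> R) (D : I -> 'I_H -> 'I_m -> R) :
  (0 < p)%N -> is_rounding p s rnd ->
  (forall t i h, 0 < A t h + C i h) ->
  (forall t t', (forall i j,
     rnd (\sum_h (B t h j + D i h j) / (A t h + C i h)) =
     rnd (\sum_h (B t' h j + D i h j) / (A t' h + C i h))) -> t = t') ->
  (#|T| <= (2 * (#|I| * m * 2 ^ p * H.+1)).+1 ^ (H + H * m))%N.
Proof.
move=> p0 [rndF _ rndM] AC0.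
set v := fun t i j => \sum_h (B t h j + D i h j) / (A t h + C i h).
move=> vI; have [lev levP] := fixed_point_enum R p s p0.
have /choice[c cP] (a : I * 'I_m * 'I_(2 ^ p)) : exists c, forall t,
    v t a.1.1 a.1.2 != c /\ (lev a.2 <= rnd (v t a.1.1 a.1.2)) = (c < v t a.1.1 a.1.2).
  apply: (threshold_gap _ _ (fun t => v t a.1.1 a.1.2) (fun y => lev a.2 <= rnd y)).
  by move=> x y xy /le_trans; apply; exact: rndM.
pose J := ('I_H + 'I_H * 'I_m)%type.
have cJ : #|{: J}| = (H + H * m)%N by rewrite card_sum card_prod !card_ord.
pose x t : 'rV[R]_#|{: J}| :=
  \row_l match enum_val l with inl h => A t h | inr hj => B t hj.1 hj.2 end.
pose a_ (y : 'rV[R]_#|{: J}|) h := y 0 (enum_rank (inl h : J)).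
pose b_ (y : 'rV[R]_#|{: J}|) h j := y 0 (enum_rank (inr (h, j) : J)).
pose f (a : I * 'I_m * 'I_(2 ^ p)) y :=
  \sum_h (b_ y h a.1.2 + D a.1.1 h a.1.2) * (\prod_(g | g != h) (a_ y g + C a.1.1 g))
  + - c a * \prod_g (a_ y g + C a.1.1 g).
have fx a t : f a (x t) = (\prod_g (A t g + C a.1.1 g)) * (v t a.1.1 a.1.2 - c a).
  have ax h : a_ (x t) h = A t h by rewrite /a_ mxE enum_rankK.
  have bx h j : b_ (x t) h j = B t h j by rewrite /b_ mxE enum_rankK.
  rewrite /f mulrBr mulr_sumr mulNr [c a * _]mulrC; congr (_ - _ * _); last first.
    by apply: eq_bigr => g _; rewrite ax.
  apply: eq_bigr => h _; rewrite bx [in RHS](bigD1 h)//=.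
  rewrite (eq_bigr (fun g => A t g + C a.1.1 g)) => [|g _]; last by rewrite ax.
  by have := AC0 t a.1.1 h; set P := \prod_(_ | _) _ => ac; field; rewrite gt_eqF.
have sizeH : size (index_enum 'I_H) = H.
  by rewrite -count_predT -sum1_count sum1_card card_ord.
have pa i g : polyfun 1 (fun y => a_ y g + C i g).
  by apply: polyfun_add; [exact: polyfun_coord|exact: polyfun_const].
have fd a : polyfun H.+1 (f a).
  apply: polyfun_add.
    apply: polyfun_sum => h _.
    (* The factors with [g != h] are counted crudely as at most H, whence the degree H + 1. *)
    apply: (polyfun_le (1 + count (fun g => g != h) (index_enum 'I_H) * 1)).
      by rewrite muln1 add1n ltnS -[leqRHS]sizeH count_size.
    apply: polyfun_mul; last by apply: polyfun_prod.
    by apply: polyfun_add; [exact: polyfun_coord|exact: polyfun_const].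
  apply: (polyfun_le (0 + count predT (index_enum 'I_H) * 1)).
    by rewrite muln1 add0n (leq_trans (count_size _ _))// sizeH.
  apply: polyfun_mul; first exact: polyfun_const.
  by apply: polyfun_prod.
have prod0 t i : 0 < \prod_g (A t g + C i g) by apply: prodr_gt0.
have -> : (#|I| * m * 2 ^ p * H.+1 = #|{: I * 'I_m * 'I_(2 ^ p)}| * H.+1)%N.
  by rewrite !card_prod !card_ord.
rewrite -cJ; apply: (card_strict_sign_patterns _ _ _ f x fd) => [a t|t t' tt'].
  by rewrite fx mulf_eq0 negb_or gt_eqF//= subr_eq0; have [] := cP a t.
apply: vI => i j.
have lev_le l : (lev l <= rnd (v t i j)) = (lev l <= rnd (v t' i j)).
  have := tt' (i, j, l); rewrite !fx !pmulr_rgt0 ?prod0// !subr_gt0.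
  by have [_ ->] := cP (i, j, l) t; have [_ ->] := cP (i, j, l) t'.
have [l1 e1] := levP _ (rndF (v t i j)); have [l2 e2] := levP _ (rndF (v t' i j)).
rewrite -/(v t i j) -/(v t' i j); apply/eqP; rewrite eq_le.
by apply/andP; split; [rewrite e1 -lev_le -e1|rewrite e2 lev_le -e2].
Qed.

(** * Words testing membership in a set *)

Definition probe (M N n : nat) (s : nat -> nat) (i : nat) (r : 'I_N) : nat :=
  if (r <= n)%N then s r else (M - n.+1 - i)%N.

Section Probe.
Variables (M N n i : nat) (s : nat -> nat).
Hypotheses (nM : (3 * n + 3 < M)%N) (nN : (n.+1 < N)%N).
Hypotheses (i_gt0 : (0 < i)%N) (i_n : (i <= n)%N).
Hypotheses (s0 : s 0 = n.+1) (s_bound : forall r, (0 < s r <= n.+1)%N).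

Lemma probe_words : words M (probe M N n s i).
Proof.
by move=> r; rewrite /probe; case: ifP => _; [have := s_bound r|]; lia.
Qed.

(** As M > 3n + 3, a sum without probe tokens lies strictly between 0 and M, and one with two of
    them strictly between M and 2M. With exactly one, the sum is M + s r - i, divisible by M only if
    s r = i. *)
Lemma Match3_probe (r0 : 'I_N) : r0 = 0 :> nat ->
  Match3 M (probe M N n s i) r0 = [exists r : 'I_n.+1, s r == i].
Proof.
move=> r00; rewrite /Match3 {1}/probe r00 /= s0.
apply/existsP/existsP => [[r1 /existsP[r2]]|[r /eqP sr]].
  rewrite mod0n => /dvdnP[q].
  rewrite /probe; case: leqP => r1n; case: leqP => r2n;
    have := s_bound r1; have := s_bound r2.
  - by case: q => [|q]; nia.
  - case: q => [|[|q]]; [lia| |nia] => h1 h2 h3.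
    by exists (Ordinal (r1n : r1 < n.+1)%N); apply/eqP => /=; lia.
  - case: q => [|[|q]]; [lia| |nia] => h1 h2 h3.
    by exists (Ordinal (r2n : r2 < n.+1)%N); apply/eqP => /=; lia.
  - by case: q => [|[|q]]; nia.
have rN : (r < N)%N by have := ltn_ord r; lia.
(* Position n + 1 is the first to carry the probe token. *)
exists (Ordinal rN); apply/existsP; exists (Ordinal nN).
rewrite /probe /= -ltnS ltn_ord ltnn sr mod0n.
have -> : (n.+1 + i + (M - n.+1 - i) = M)%N by lia.
by rewrite modnn.
Qed.

(** The first sum depends only on [s], the second only on i: this is the source of the additive
    parameters. *)
Lemma sum_probe (R : realType) (F : nat -> R) :
  \sum_(r < N) F (probe M N n s i r) =
  \sum_(r < N | (r <= n)%N) F (s r) +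
  \sum_(r < N | ~~ (r <= n)%N) F (M - n.+1 - i)%N.
Proof.
rewrite (bigID (fun r : 'I_N => (r <= n)%N)) /=.
by congr (_ + _); apply: eq_bigr => r rn; rewrite /probe ?rn// (negbTE rn).
Qed.

End Probe.

(** * Outputs of a one-layer transformer *)

Lemma self_attention_row (R : realType) (N d m d' : nat) (Q K : 'M[R]_(d, m))
    (V : 'M[R]_(d, d')) (X : 'M[R]_(N, d)) i j :
  let w r := expR ((row i X *m Q *m K^T *m (row r X)^T) 0 0) in
  self_attention Q K V X i j =
  (\sum_r w r * (row r X *m V) 0 j) / \sum_r w r.
Proof.
move=> w.
have wE r : expR ((X *m Q *m K^T *m X^T) i r) = w r.
  rewrite /w -!row_mul; congr expR.
  by rewrite [RHS]mxE mxE [RHS]mxE; apply: eq_bigr => l _; rewrite !mxE.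
rewrite /self_attention -mulmxA mxE mulr_suml; apply: eq_bigr => r _.
rewrite -row_mul mxE wE (eq_bigr w) => [|r' _]; last exact: wE.
by rewrite [in RHS]mxE mulrAC.
Qed.

(** The first conclusion serves to bound n by 2 ^ p. In the second, [E] is the unnormalised
    attention weight for query z and key x, and [W] the value vector of x; the input MLP is absorbed
    in both. *)
Lemma transformer1_row (R : realType) (N H m p : nat) f :
  @transformer1 R N H 1 m 1 p f ->
  (exists (s : int) (rnd : R -> R), is_rounding p s rnd /\
     forall X, f X = f (map_mx rnd X)) /\
  exists (s : int) (rnd : R -> R) (E : R -> 'I_H -> R -> R) (W : 'I_H -> R -> 'I_m -> R)
    (psi : 'rV[R]_m -> R),
  [/\ is_rounding p s rnd, forall z h x, 0 < E z h x &
  forall X i, f X i 0 = psi (\row_j rnd (\sum_h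
    (\sum_r E (X i 0) h (X r 0) * W h (X r 0) j) / \sum_r E (X i 0) h (X r 0)))].
Proof.
move=> [phi [g [psi [[[s [rnd [rnds phi_rnd]]] _] [fs [fsP ->]]]]]].
move=> [[s' [rnd' [rnds' psi_rnd]]] _] ->.
split.
  exists s, rnd; split=> // X.
  rewrite /= (_ : rowwise phi (map_mx rnd X) = rowwise phi X)//.
  apply/matrixP => i j; rewrite !mxE [in RHS]phi_rnd.
  by congr (phi _ 0 j); apply/rowP => l; rewrite !mxE.
have /choice[QKV QKVP] h : exists QKV : 'M[R]_m * 'M[R]_m * 'M[R]_m,
    fs h = self_attention QKV.1.1 QKV.1.2 QKV.2.
  by have [Q [K [V [_ _ _ ->]]]] := fsP h; exists (Q, K, V).
pose tok (x : R) : 'rV[R]_m := phi (const_mx x).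
exists s', rnd',
  (fun z h x => expR ((tok z *m (QKV h).1.1 *m (QKV h).1.2^T *m (tok x)^T) 0 0)),
  (fun h x j => (tok x *m (QKV h).2) 0 j), (fun y => psi y 0 0).
split=> // [z h x|X i]; first exact: expR_gt0.
rewrite /= mxE psi_rnd; congr (psi _ 0 0); apply/rowP => j; rewrite !mxE summxE.
congr rnd'; apply: eq_bigr => h _; rewrite QKVP self_attention_row.
have tokE r : row r (rowwise phi X) = tok (X r 0).
  rewrite /tok; apply/rowP => l; rewrite !mxE; congr (phi _ 0 l).
  by apply/rowP => c; rewrite !mxE ord1.
rewrite !tokE; congr (_ / _); first by apply: eq_bigr => r _; rewrite !tokE.
by apply: eq_bigr => r _; rewrite !tokE.
Qed.

(** * Lower bounds for transformers computing [Match3] *)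

Section LowerBound.
Context {R : realType}.
Variables (N M m p H n : nat) (f : 'M[R]_(N, 1) -> 'M[R]_(N, 1)).
Hypotheses (p0 : (0 < p)%N) (nM : (3 * n + 3 < M)%N) (nN : (n.+1 < N)%N).
Hypothesis fT : @transformer1 R N H 1 m 1 p f.
Hypothesis f_Match3 : forall X : 'I_N -> nat, words M X ->
  f (\col_i (X i)%:R) = \col_i (Match3 M X i)%:R.

Let r0 : 'I_N := Ordinal (ltn_trans (ltn0Sn n) nN).

Let f_probe s i : s 0 = n.+1 -> (forall r, 0 < s r <= n.+1)%N -> (0 < i <= n)%N ->
  f (\col_r (probe M N n s i r)%:R) r0 0 = [exists r : 'I_n.+1, s r == i]%:R.
Proof.
move=> s0 sb /andP[i0 i_n]; rewrite f_Match3; last exact: probe_words.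
by rewrite mxE Match3_probe.
Qed.

(** If rounding identified two tokens among 1, ..., n, words differing only in these at position 1
    would have the same output, yet a probe for one of them tells the words apart. *)
Lemma precision_lower_bound : (n <= 2 ^ p)%N.
Proof.
have [[t [rnd [[rndF _ _] f_rnd]]] _] := transformer1_row _ _ _ _ _ _ fT.
have [lev levP] := fixed_point_enum R p t p0.
have /choice[l lP] : forall i : 'I_n, exists l, rnd i.+1%:R = lev l.
  by move=> i; exact: levP.
have lI : injective l; last by have := leq_card l lI; rewrite !card_ord.
move=> i i' ll'.
pose s (j r : nat) := if r == 1%N then j.+1 else n.+1.
have sb (j : 'I_n) r : (0 < s j r <= n.+1)%N.
  by rewrite /s; case: ifP => _ //; have := ltn_ord j; lia.
have i_n : (0 < i.+1 <= n)%N := ltn_ord i.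
have := f_probe (s i) i.+1 erefl (sb i) i_n.
rewrite f_rnd (_ : map_mx rnd _ = map_mx rnd (\col_r (probe M N n (s i') i.+1 r)%:R)).
  rewrite -f_rnd f_probe// => /eqP; rewrite eqr_nat.
  have -> : [exists r : 'I_n.+1, s i r == i.+1].
    apply/existsP; have n1 : (1 < n.+1)%N by have := ltn_ord i; lia.
    by exists (Ordinal n1); rewrite /s.
  rewrite eqb1 => /existsP[r]; rewrite /s; case: ifP => _ /eqP.
    by move=> [ii']; exact: val_inj.
  by have := ltn_ord i; lia.
apply/matrixP => r c; rewrite !mxE /probe; case: ifP => // _.
by rewrite /s; case: ifP => // _; rewrite !lP ll'.
Qed.

Lemma capacity_lower_bound :
  (2 ^ n <= (2 * (n * m * 2 ^ p * H.+1)).+1 ^ (H + H * m))%N.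
Proof.
have [_ [t [rnd [E [W [psi [rndP E0 fE]]]]]]] := transformer1_row _ _ _ _ _ _ fT.
(* Non-elements are filled with the token n + 1, which no probe i <= n tests. *)
pose s (S : {set 'I_n}) (r : nat) :=
  if [exists j in S, r == j.+1] then r else n.+1.
have s0 S : s S 0 = n.+1 by rewrite /s; case: existsP => // -[j /andP[_]].
have sb S r : (0 < s S r <= n.+1)%N.
  rewrite /s; case: existsP => [[j /andP[_ /eqP ->]]|_]; last lia.
  by have := ltn_ord j; lia.
have sE S (i : 'I_n) : [exists r : 'I_n.+1, s S r == i.+1] = (i \in S).
  have := ltn_ord i => i_n.
  apply/existsP/idP => [[r]|iS].
    rewrite /s; case: existsP => [[j /andP[jS /eqP ->]] /eqP[ji]|_ /eqP]; last by lia.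
    by rewrite (_ : i = j)//; exact: val_inj.
  exists (Ordinal (i_n : i.+1 < n.+1)%N); rewrite /s /=.
  by rewrite ifT//; apply/existsP; exists i; rewrite iS eqxx.
(* Every word has this token at position 0, so the weights [E z h] are the same functions for all
   sets and probes. *)
pose z : R := n.+1%:R.
pose w (i : 'I_n) : nat := (M - n.+1 - i.+1)%N.
have := @card_rounded_fractions R {set 'I_n} 'I_n m H p t rnd
  (fun S h => \sum_(r < N | (r <= n)%N) E z h (s S r)%:R)
  (fun S h j => \sum_(r < N | (r <= n)%N) E z h (s S r)%:R * W h (s S r)%:R j)
  (fun i h => \sum_(r < N | ~~ (r <= n)%N) E z h (w i)%:R)
  (fun i h j => \sum_(r < N | ~~ (r <= n)%N) E z h (w i)%:R * W h (w i)%:R j) p0 rndP.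
rewrite -[#|{set 'I_n}|]cardsT -powersetT card_powerset cardsT !card_ord.
apply => [S i h|S S' SS'].
  rewrite -(sum_probe M N n i.+1 (s S) R (fun x => E z h x%:R)).
  rewrite (bigD1 r0)//= ltr_wpDr ?E0// sumr_ge0// => r _; exact: ltW.
have bool_inj : injective (fun b : bool => b%:R : R).
  by move=> b b' /eqP; rewrite eqr_nat; case: b; case: b'.
apply/setP => i; rewrite -!sE; apply: bool_inj.
have i_n : (0 < i.+1 <= n)%N := ltn_ord i.
(* Membership of i is the output at position 0, a function of the rounded fractions that S and S'
   share. *)
rewrite /= -!f_probe// !fE; congr psi; apply/rowP => j; rewrite !mxE.
have zE S'' : (probe M N n (s S'') i.+1 r0)%:R = z by rewrite /probe /= s0.
have colE S'' (F : R -> R) :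
    \sum_r F ((\col_r (probe M N n (s S'') i.+1 r)%:R) r (0 : 'I_1)) =
    \sum_(r < N | (r <= n)%N) F (s S'' r)%:R +
    \sum_(r < N | ~~ (r <= n)%N) F (w i)%:R.
  rewrite -(sum_probe M N n i.+1 (s S'') R (fun x => F x%:R)).
  by apply: eq_bigr => r _; rewrite mxE.
rewrite !zE; have := SS' i j; congr (rnd _ = rnd _); apply: eq_bigr => h _; symmetry.
- by rewrite (colE S (E z h)) (colE S (fun x => E z h x * W h x j)).
- by rewrite (colE S' (E z h)) (colE S' (fun x => E z h x * W h x j)).
Qed.

End LowerBound.

(** * Numerical conclusion *)

(** Since N <= 8 * 2 ^ p, the base is at most 2 ^ (9 p); the total exponent is then at most 18 m p H
    <= 18 N / 200, below n = N / 4 rounded down. *)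
Lemma capacity_arith (n m p H N : nat) : (0 < m)%N -> (0 < p)%N -> (0 < H)%N ->
  (5 <= N)%N -> n = (N %/ 4)%N -> (n <= 2 ^ p)%N -> (200 * (m * p * H) <= N)%N ->
  (2 ^ n <= (2 * (n * m * 2 ^ p * H.+1)).+1 ^ (H + H * m))%N -> False.
Proof.
move=> m0 p0 H0 N5 nE np mpHN.
apply/negP; rewrite -ltnNge.
have base : ((2 * (n * m * 2 ^ p * H.+1)).+1 <= 2 ^ (9 * p))%N.
  have mH : (m * H <= N)%N by nia.
  have N8 : (N <= 8 * 2 ^ p)%N by lia.
  apply: (@leq_trans (2 ^ 6 * (2 ^ p * 2 ^ p * 2 ^ p))%N).
    have mH1 : (m * H.+1 <= 16 * 2 ^ p)%N by nia.
    have := leq_mul np mH1; have : (0 < 2 ^ p)%N by rewrite expn_gt0.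
    set P := (2 ^ p)%N => P0 h.
    have h2 : (n * m * P * H.+1 <= 16 * (P * P * P))%N by nia.
    have h3 : (0 < P * P * P)%N by rewrite !muln_gt0 P0.
    lia.
  by rewrite -!expnD leq_exp2l//; lia.
apply: leq_ltn_trans (_ : 2 ^ (9 * p * (H + H * m)) < _)%N.
  by rewrite expnM leq_exp2r//; nia.
rewrite ltn_exp2l//.
have : (H + H * m <= 2 * (H * m))%N by nia.
have : (9 * p * (2 * (H * m)) < n)%N by nia.
nia.
Qed.

Theorem theorem7 (R : realType) :
  exists c : R, 0 < c /\
  exists N0 : nat, forall N M : nat, (N0 <= N)%N -> (N + 1 <= M)%N ->
  forall m p H : nat, (0 < m)%N -> (0 < p)%N -> (0 < H)%N ->
  (m * p * H)%:R <= c * N%:R / ln (ln N%:R) ->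
  ~ exists f : 'M[R]_(N, 1) -> 'M[R]_(N, 1),
      @transformer1 R N H 1 m 1 p f /\
      forall X : 'I_N -> nat, words M X ->
        f (\col_i (X i)%:R) = \col_i (Match3 M X i)%:R.
Proof.
exists 200%:R^-1; split; first by rewrite invr_gt0.
(* The bound 16 gives room for 3 (N / 4) + 3 < M; the double exponential makes ln (ln N) at least 1,
   so that 200 m p H <= N. *)
exists (maxn 16 (Num.truncn (expR (expR (1 : R)))).+1) => N M.
rewrite geq_max => /andP[N16 Nexp] NM m p H m0 p0 H0 mpH [f [fT fM]].
have lnlnN : 1 <= ln (ln (N%:R : R)).
  have eN : expR (expR 1) <= N%:R :> R.
    by rewrite (le_trans (ltW (truncnS_gt _)))// ler_nat.
  have N0 : 0 < N%:R :> R by rewrite (lt_le_trans (expR_gt0 _) eN).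
  have elnN : expR 1 <= ln N%:R :> R by rewrite -ler_expR lnK ?posrE.
  by rewrite -ler_expR lnK ?posrE// (lt_le_trans (expR_gt0 _) elnN).
have mpHN : (200 * (m * p * H) <= N)%N.
  rewrite -(ler_nat R) natrM -ler_pdivlMl//.
  apply: le_trans mpH _; rewrite ler_piMr ?mulr_ge0 ?invr_ge0//.
  by rewrite invf_le1 ?(lt_le_trans ltr01).
have nM : (3 * (N %/ 4) + 3 < M)%N by lia.
have nN : ((N %/ 4).+1 < N)%N by lia.
apply: (capacity_arith (N %/ 4) m p H N) => //; first lia.
  exact: precision_lower_bound nM nN fT fM.
exact: capacity_lower_bound nM nN fT fM.
Qed.
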